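(* For any $\Delta>0$, every (possibly randomized, possibly adaptive) query algorithm for Graph Reconstruction using a Maximal Independent Set oracle with success probability strictly greater than $1/2$ requires $\Omega(\Delta^2)$ queries on graphs of maximum degree $\Delta$.
   Context: Graph Reconstruction problem: an algorithm initially knows only the vertex set $V$ of an unknown simple undirected input graph $G=(V,E)$ and must determine $E$. Access to $G$ is only via a Maximal Independent Set oracle: in each query the algorithm submits a subset $U\subseteq V$, and the oracle returns an arbitrary (possibly adversarially chosen) maximal independent set of the induced subgraph $G[U]$. The query complexity is the number of oracle calls. *)

(* Defs.v *)
From mathcomp Require Import all_boot.

Set Implicit Arguments.
Unset Strict Implicit.
Unset Printing Implicit Defensive.

Record sgraph (V : finType) := SGraph {
  edges : {set {set V}};
  edges_card2 : forall e : {set V}, e \in edges -> #|e| = 2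
}.

Definition degree (V : finType) (G : sgraph V) (v : V) : nat :=
  #|[set e in edges G | v \in e]|.

Definition max_degree (V : finType) (G : sgraph V) : nat :=
  \max_(v : V) degree G v.

Definition independent (V : finType) (G : sgraph V) (I : {set V}) : bool :=
  [forall e in edges G, ~~ (e \subset I)].

(* A set contained in U is independent in G[U] iff it is independent in G. *)
Definition is_mis (V : finType) (G : sgraph V) (U I : {set V}) : bool :=
  maxset (fun J : {set V} => (J \subset U) && independent G J) I.

(* The (query, answer) pairs so far, oldest first. *)
Definition transcript (V : finType) := seq ({set V} * {set V}).

(* An oracle may be adaptive: its answer may depend on the earlier exchanges,
   so that the same query may receive different answers. *)
Definition oracle (V : finType) := transcript V -> {set V} -> {set V}.

Definition mis_oracle (V : finType) (G : sgraph V) (O : oracle V) : Prop :=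
  forall (h : transcript V) (U : {set V}), is_mis G U (O h U).

(* Deterministic adaptive algorithms on the vertex set V, as decision trees:
   either stop and announce an edge set, or query U and continue according to
   the answer.  A randomized algorithm is a random decision tree. *)
Inductive algorithm (V : finType) : Type :=
| Output of {set {set V}}
| Query of {set V} & ({set V} -> algorithm V).

Fixpoint run_from (V : finType) (O : oracle V) (h : transcript V)
    (A : algorithm V) : transcript V * {set {set V}} :=
  match A with
  | Output E => (h, E)
  | Query U next => let I := O h U in run_from O (rcons h (U, I)) (next I)
  end.

Definition output (V : finType) (A : algorithm V) (O : oracle V) :
  {set {set V}} := (run_from O [::] A).2.

Definition num_queries (V : finType) (A : algorithm V) (O : oracle V) : nat :=
  size (run_from O [::] A).1.

(* Main.v *)
(* Split Delta >= 2 into two nearly equal parts, join L and R of these sizes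
   completely, add an apex z adjacent to everything, and consider this graph
   together with all graphs obtained by removing one edge xy with x in L and
   y in R.  For every query U some answer is valid for all these graphs except
   possibly one: take U on L if it has two vertices there, else U on R if it
   has two vertices there; only when U meets L and R in x and y alone does the
   answer betray whether xy is present.  Hence along a fixed decision tree each
   query singles out at most one graph, so a tree making q queries on the full
   graph identifies at most q + 1 of the N = |L| |R| + 1 graphs.  As each is
   identified with probability above 1/2, with positive probability more than
   N/2 are, and then 2 q >= |L| |R|.  For Delta = 1 two graphs with one edge
   each play the same role. *)
Require Import Defs.
From HB Require Import structures.
From mathcomp Require Import all_boot all_order all_algebra.
From mathcomp Require Import all_classical all_reals all_analysis.
From mathcomp Require Import measurable_realfun zify.
Set Implicit Arguments.
Unset Strict Implicit.
Unset Printing Implicit Defensive.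
Import Order.TTheory GRing.Theory Num.Theory.
Local Open Scope classical_set_scope.
Local Open Scope ring_scope.

(** * Averaging over the random tree, and counting the graphs that one tree recognizes *)

(** The expected number of events [T j] that occur is the sum of their probabilities, hence above
    [#|J| / 2]; this count cannot then be at most [#|J| / 2] almost surely. *)
Lemma card_gt_half_prob_gt0 (R : realType) (d : measure_display)
    (Omega : measurableType d) (P : probability Omega R)
    (J : finType) (T : J -> set Omega) :
  (0 < #|J|)%N -> (forall j, measurable (T j)) ->
  (forall j, ((2^-1 : R)%:E < P (T j))%E) ->
  (0 < P [set w | (#|J| < 2 * #|[pred j | w \in T j]|)%N])%E.
Proof.
move=> J0 mT PT; set B := [set w | _].
have sumE w : ((\sum_(j : J) (\1_(T j) w : R)) = #|[pred j | w \in T j]|%:R)%R.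
  rewrite -sum1_card natr_sum [RHS]big_mkcond/=; apply: eq_bigr => j _.
  by rewrite indicE inE; case: (w \in T j).
have mh : measurable_fun setT (fun w => \sum_(j : J) (\1_(T j) w : R)).
  by apply: measurable_sum => j; exact: measurable_indic.
have mB : measurable B.
  have -> : B = setT `&`
      (fun w => \sum_(j : J) (\1_(T j) w : R)) @^-1` `](#|J|%:R / 2), +oo[.
    rewrite setTI; apply/seteqP; split=> w /=;
      rewrite in_itv/= andbT sumE ltr_pdivrMr// -natrM ltr_nat mulnC //.
  exact: mh.
rewrite lt0e measure_ge0 andbT; apply/eqP => PB0.
(* Removing the null set [B] from every [T j] changes no probability and makes the count at most
   [#|J| / 2] everywhere, so a pointwise bound can be integrated. *)
have TB j : P (T j) = P (T j `\` B).
  apply/eqP; rewrite eq_le; apply/andP; split; last first.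
    by apply: le_measure; rewrite ?inE//; exact: measurableD.
  rewrite (measureDI P (mT j) mB) -[leRHS]adde0 leeD2l//.
  rewrite -PB0; apply: le_measure; rewrite ?inE//; first exact: measurableI.
have : (\sum_(j : J) P (T j) <= (#|J|%:R / 2)%:E)%E.
  have -> : (\sum_(j : J) P (T j) =
      \int[P]_w (\sum_(j : J) (\1_(T j `\` B) w)%:E))%E.
    rewrite ge0_integral_sum//.
    - apply: eq_bigr => j _; rewrite integral_indic ?setIT ?TB//.
      exact: measurableD.
    - move=> j; apply/measurable_EFinP; apply: measurable_indic.
      exact: measurableD.
  have -> : (#|J|%:R / 2)%:E = (\int[P]_w (cst (#|J|%:R / 2 : R)%:E w))%E.
    by rewrite integral_cst// [X in (_ * X)%E]probability_setT mule1.
  apply: ge0_le_integral => //.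
  - by move=> w _; apply: sume_ge0 => j _.
  - apply: emeasurable_sum => j; apply/measurable_EFinP.
    by apply: measurable_indic; exact: measurableD.
  - move=> w _; rewrite sumEFin lee_fin.
    have [wB|wB] := pselect (B w).
      rewrite big1 ?divr_ge0// => j _.
      by rewrite indicE memNset// => -[].
    have -> : \sum_(j : J) (\1_(T j `\` B) w : R) =
              \sum_(j : J) (\1_(T j) w : R).
      apply: eq_bigr => j _; rewrite !indicE in_setD.
      by rewrite (memNset wB) andbT.
    rewrite sumE ler_pdivlMr// -natrM ler_nat mulnC leqNgt.
    exact/negP.
apply/negP; rewrite -ltNge.
have -> : (#|J|%:R / 2 : R)%:E = (\sum_(j : J) (2^-1 : R)%:E)%E.
  by rewrite sumEFin sumr_const mulr_natl.
(* One index is split off to keep the inequality strict; this is where [J] must be nonempty. *)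
have [j0 _] : exists j0 : J, j0 \in J by apply/card_gt0P.
rewrite (bigD1 j0)//= [ltRHS](bigD1 j0)//=; apply: lte_leD => //.
  by rewrite sumEFin.
by apply: lee_sum => j _; exact: ltW.
Qed.

(* Each query tells at most one member of the family apart from the others, so
   it can make at most one more member be recognized. *)
Lemma card_recognized (V J : finType) (j0 : J) (O : J -> oracle V)
    (E : J -> {set {set V}}) (A : algorithm V) :
  injective E ->
  (forall U, exists e, forall j h, j != e -> O j h U = O j0 h U) ->
  (#|[pred j | output A (O j) == E j]| <= (num_queries A (O j0)).+1)%N.
Proof.
move=> injE sepO; rewrite /output /num_queries.
suff H h : (#|[pred j | (run_from (O j) h A).2 == E j]| + size h
            <= (size (run_from (O j0) h A).1).+1)%N.
  by have := H [::]; rewrite addn0.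
elim: A h => [F|U next IH] h /=.
  rewrite -[leqRHS]add1n leq_add2r; apply/card_le1_eqP => i j.
  by rewrite !inE => /eqP -> /eqP/injE.
have [e He] := sepO U.
apply: leq_trans (IH (O j0 h U) (rcons h (U, O j0 h U))).
rewrite size_rcons addnS -addSn leq_add2r.
rewrite (cardD1 e) -[leqRHS]add1n leq_add ?leq_b1//.
apply/subset_leq_card/fintype.subsetP => j; rewrite !inE => /andP[je].
by rewrite (He _ _ je).
Qed.

Lemma mis_exists (V : finType) (G : sgraph V) (U : {set V}) :
  exists I, is_mis G U I.
Proof.
have P0 : (finset.set0 \subset U) && independent G finset.set0.
  rewrite finset.sub0set; apply/forall_inP => e /edges_card2 e2.
  by rewrite finset.subset0 -cards_eq0 e2.
by have [I mI _] := maxset_exists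
  (P := fun J => (J \subset U) && independent G J) P0; exists I.
Qed.

(** This reduces the lower bound to a family of graphs in which each query has an answer valid for
    [G j0] and for all other members but at most one. Queries are counted on [G j0]. *)
Lemma indistinguishable_family (R : realType) (V J : finType) (j0 : J)
    (G : J -> sgraph V) (Delta : nat) (d : measure_display)
    (Omega : measurableType d) (P : probability Omega R)
    (A : Omega -> algorithm V) :
  (forall S : set (algorithm V), measurable (A @^-1` S)) ->
  (forall (H : sgraph V) (O : oracle V),
     max_degree H = Delta -> mis_oracle H O ->
     ((2^-1 : R)%:E < P [set w | output (A w) O = edges H])%E) ->
  injective (fun j => edges (G j)) -> (forall j, max_degree (G j) = Delta) ->
  (forall U, exists I e,
     is_mis (G j0) U I /\ forall j, j != e -> is_mis (G j) U I) ->
  exists2 O : oracle V, mis_oracle (G j0) O &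
    (0 < P [set w | (#|J|.-1 <= 2 * num_queries (A w) O)%N])%E.
Proof.
move=> mA succ injG degG sepG.
have [f fP] := choice sepG.
have [g gP] := choice (fun jU : J * {set V} => mis_exists (G jU.1) jU.2).
(* The oracles ignore the history and give the shared answer [f U] whenever it is valid; the
   fallback [g] can occur only at the exceptional index of [U]. *)
pose O (j : J) : oracle V :=
  fun _ U => if is_mis (G j) U (f U) then f U else g (j, U).
have misO j : mis_oracle (G j) (O j).
  by move=> h U; rewrite /O; case: ifP => // _; exact: (gP (j, U)).
exists (O j0) => //.
have sepO U : exists e, forall j h, j != e -> O j h U = O j0 h U.
  have [e [m0 me]] := fP U; exists e => j h /me mj.
  by rewrite /O m0 mj.
have J0 : (0 < #|J|)%N by apply/card_gt0P; exists j0.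
have := card_gt_half_prob_gt0 (P := P)
  (T := fun j => [set w | output (A w) (O j) = edges (G j)]) J0.
move=> /(_ (fun j => mA [set a | output a (O j) = edges (G j)])).
move=> /(_ (fun j => succ _ _ (degG j) (misO j))) /lt_le_trans; apply.
have mS (Q : algorithm V -> Prop) : measurable [set w | Q (A w)].
  exact: (mA [set a | Q a]).
apply: le_measure; rewrite ?inE.
- exact: (mS (fun a => (#|J| < 2 *
    #|[pred j | a \in [set a' | output a' (O j) = edges (G j)]]|)%N)).
- exact: (mS (fun a => (#|J|.-1 <= 2 * num_queries a (O j0))%N)).
- move=> w /=.
  have := card_recognized (A w) injG sepO.
  have -> : #|[pred j | output (A w) (O j) == edges (G j)]| =
    #|[pred j | w \in [set w | output (A w) (O j) = edges (G j)]]|.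
    apply: eq_card => j; rewrite !inE.
    by apply/eqP/idP => [?|/set_mem//]; exact: mem_set.
  (* From [#|J| < 2 * n] and [n <= m.+1] follows [#|J| <= 2 * m + 1]. *)
  set n := #|_|; set m := num_queries _ _; move: J0 => /=; lia.
Qed.

(** * Graphs given by relations, and their maximal independent sets *)

(** The cardinality test discards loops, so that every relation yields an [sgraph]. *)
Definition rel_edges (V : finType) (r : rel V) : {set {set V}} :=
  [set e : {set V} | (#|e| == 2) &&
     [exists x, exists y, (e == [set x; y]%SET) && r x y]]%SET.

Lemma rel_edges_card2 (V : finType) (r : rel V) (e : {set V}) :
  e \in rel_edges r -> #|e| = 2%N.
Proof. by rewrite inE => /andP[/eqP]. Qed.

Definition rel_graph (V : finType) (r : rel V) : sgraph V :=
  SGraph (@rel_edges_card2 V r).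

Lemma in_rel_edges (V : finType) (r : rel V) (x y : V) :
  symmetric r -> x != y -> ([set x; y]%SET \in rel_edges r) = r x y.
Proof.
move=> symr xy; rewrite inE cards2 xy /=.
apply/existsP/idP => [[u /existsP[v /andP[/eqP e ruv]]]|rxy]; last first.
  by exists x; apply/existsP; exists y; rewrite eqxx.
have : x \in [set u; v]%SET by rewrite -e !inE eqxx.
have : y \in [set u; v]%SET by rewrite -e !inE eqxx orbT.
rewrite !inE => /orP[]/eqP yE /orP[]/eqP xE; move: xy;
  by rewrite xE yE ?eqxx // symr.
Qed.

Lemma degree_rel_graph (V : finType) (r : rel V) (v : V) :
  symmetric r -> irreflexive r -> degree (rel_graph r) v = #|[pred y | r v y]|.
Proof.
move=> symr irr; rewrite /degree.
have neq y : r v y -> v != y by apply: contraTneq => ->; rewrite irr.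
rewrite -[RHS](@card_in_imset _ _ (fun y => [set v; y]%SET)).
  apply: eq_card => e; rewrite !inE; apply/andP/imsetP.
    move=> [/andP[_ /existsP[x /existsP[y /andP[/eqP -> rxy]]]]].
    rewrite !inE => /orP[]/eqP vE; rewrite vE; first by exists y; rewrite ?inE.
    by exists x; rewrite ?inE 1?symr // finset.setUC.
  move=> [y]; rewrite inE => rvy ->; split; last by rewrite !inE eqxx.
  by have := in_rel_edges symr (neq _ rvy); rewrite inE rvy.
move=> y y'; rewrite !inE => /neq vy _ e.
have : y \in [set v; y']%SET by rewrite -e !inE eqxx orbT.
by rewrite !inE eq_sym (negPf vy) => /eqP.
Qed.

(** Vertices outside [K] are isolated and belong to every maximal independent set of a query
    containing them; inside [K], the independent set [S] dominates the rest of [U]. The answer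
    depends on [r] only through [K] and [S], so several graphs can share it. *)
Lemma is_mis_rel_graph (V : finType) (r : rel V) (K S U : {set V}) :
  symmetric r ->
  (forall x y, r x y -> x \in K) ->
  {in S &, forall x y, ~~ r x y} ->
  {in U, forall u, u \in K -> u \notin S ->
     exists2 s, s \in S & (s \in U) && r u s} ->
  is_mis (rel_graph r) U (U :\: (K :\: S)).
Proof.
move=> symr rK indS domS; apply/maxsetP; split.
  rewrite finset.subsetDl; apply/forall_inP => e.
  rewrite inE => /andP[_ /existsP[x /existsP[y /andP[/eqP -> rxy]]]].
  have xK := rK _ _ rxy; have yK : y \in K by apply: (rK y x); rewrite symr.
  apply/negP => /fintype.subsetP sub.
  have := sub x; have := sub y; rewrite !inE !eqxx orbT xK yK !andbT !negbK.
  move=> /(_ isT)/andP[yS _] /(_ isT)/andP[xS _].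
  by have := indS x y xS yS; rewrite rxy.
move=> J /andP[/fintype.subsetP JU indJ] /fintype.subsetP subJ.
apply/eqP; rewrite finset.eqEsubset; apply/andP; split;
  apply/fintype.subsetP => //.
move=> u uJ; rewrite !inE (JU _ uJ) andbT; apply/negP => /andP[uS uK].
have [s sS /andP[sU rus]] := domS u (JU _ uJ) uK uS.
have sJ : s \in J by apply: subJ; rewrite !inE sS sU.
have us : u != s by apply: contraNneq uS => ->.
move/forall_inP: indJ => /(_ ([set u; s]%SET)).
rewrite /= in_rel_edges // => /(_ rus)/negP; apply.
by apply/fintype.subsetP => x; rewrite !inE => /orP[]/eqP ->.
Qed.

Lemma subset_of_card (T : finType) (A : {set T}) n :
  (n <= #|A|)%N -> exists2 B : {set T}, B \subset A & #|B| = n.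
Proof.
move=> /card_geqP[s [us ss sA]]; exists (finset.finset (mem s)).
  by apply/fintype.subsetP => x; rewrite inE; exact: sA.
by rewrite cardsE (card_uniqP us).
Qed.

(** * Complete bipartite graphs with an apex, minus at most one edge *)

Section HardGraphs.
Variables (V : finType) (L R : {set V}) (z : V).
Hypotheses (notin_R : {in L, forall x, x \notin R})
  (zL : z \notin L) (zR : z \notin R).

(* The apex z keeps the maximum degree at |L| + |R| on only |L| + |R| + 1
   vertices. *)
Definition cone_rel (j : option (V * V)) : rel V :=
  let r x y := (x == z) && (y \in L :|: R)%SET ||
    [&& x \in L, y \in R & j != Some (x, y)] in
  fun x y => r x y || r y x.

Lemma cone_relC j : symmetric (cone_rel j).
Proof. by move=> x y; rewrite /cone_rel orbC. Qed.

Lemma notin_L x : x \in R -> x \notin L.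
Proof. by move=> xR; apply: contraL xR; exact: notin_R. Qed.

Lemma cone_rel_irr j : irreflexive (cone_rel j).
Proof.
move=> x; rewrite /cone_rel orbb !inE; apply/negP => /orP[/andP[/eqP->]|].
  by rewrite (negPf zL) (negPf zR).
by case/and3P => /notin_R/negPf ->.
Qed.

Lemma cone_relLR j x y : x \in L -> y \in R ->
  cone_rel j x y = (j != Some (x, y)).
Proof.
move=> xL yR; rewrite /cone_rel !inE xL yR (negPf (notin_R xL)).
rewrite (negPf (notin_L yR)) /= orbF.
have -> : (x == z) = false by apply: contraNF zL => /eqP <-.
have -> : (y == z) = false by apply: contraNF zR => /eqP <-.
by rewrite orbF.
Qed.

Lemma cone_relz j y : y \in (L :|: R)%SET -> cone_rel j z y.
Proof. by move=> yLR; rewrite /cone_rel eqxx yLR. Qed.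

Lemma cone_rel_core j x y : cone_rel j x y -> x \in (z |: (L :|: R))%SET.
Proof.
rewrite /cone_rel !inE.
case: (x == z) => //=; case: (x \in L) => //=; case: (x \in R) => //=.
by rewrite !andbF.
Qed.

Lemma card_core : #|(z |: (L :|: R))%SET| = (#|L| + #|R|).+1.
Proof.
rewrite cardsU1 !inE (negPf zL) (negPf zR) /= cardsU.
rewrite (_ : (L :&: R)%SET = finset.set0) ?cards0 ?subn0 //.
apply/setP => x; rewrite !inE; apply/negP => /andP[/notin_R].
by move=> /negP xR /xR.
Qed.

(** No edge leaves the core of [|L| + |R| + 1] vertices, which bounds every degree; the apex attains
    the bound and loses no edge, so the whole family has the same maximum degree. *)
Lemma max_degree_cone j : max_degree (rel_graph (cone_rel j)) = (#|L| + #|R|)%N.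
Proof.
have deg := degree_rel_graph _ (cone_relC j) (cone_rel_irr j).
apply/eqP; rewrite eqn_leq; apply/andP; split.
  apply/bigmax_leqP => v _; rewrite deg.
  have [v0|[y vy]] := finset.set_0Vmem [set y | cone_rel j v y]%SET.
    have -> // : #|[pred y | cone_rel j v y]| = 0%N.
    by apply: eq_card0 => y; have := finset.in_set0 y; rewrite -v0 !inE.
  have vK : v \in (z |: (L :|: R))%SET.
    by move: vy; rewrite inE; exact: cone_rel_core.
  rewrite -ltnS -card_core (cardsD1 v) vK add1n ltnS.
  apply/subset_leq_card/fintype.subsetP => x; rewrite inE => vx.
  rewrite in_setD1; apply/andP; split; last first.
    by apply: (@cone_rel_core j x v); rewrite cone_relC.
  by apply: contraTneq vx => ->; rewrite cone_rel_irr.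
apply: leq_trans (leq_bigmax z); rewrite deg -ltnS -card_core.
rewrite cardsU1 !inE (negPf zL) (negPf zR) add1n ltnS.
apply/subset_leq_card/fintype.subsetP => x xLR.
by rewrite inE; exact: cone_relz.
Qed.

Lemma cone_rel_indL j : {in L &, forall x y, ~~ cone_rel j x y}.
Proof.
move=> x y xL yL; rewrite /cone_rel (negPf (notin_R xL)) (negPf (notin_R yL)).
have -> : (x == z) = false by apply: contraNF zL => /eqP <-.
have -> : (y == z) = false by apply: contraNF zL => /eqP <-.
by rewrite !andbF.
Qed.

Lemma cone_rel_indR j : {in R &, forall x y, ~~ cone_rel j x y}.
Proof.
move=> x y xR yR; rewrite /cone_rel (negPf (notin_L xR)) (negPf (notin_L yR)).
have -> : (x == z) = false by apply: contraNF zR => /eqP <-.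
have -> : (y == z) = false by apply: contraNF zR => /eqP <-.
by [].
Qed.

(** [None] is the intact graph. Restricting the pairs to [L] times [R] makes different indices give
    different graphs. *)
Definition removable := option {p : V * V | p \in finset.setX L R}.

Definition cone_graph (j : removable) : sgraph V :=
  rel_graph (cone_rel (omap val j)).

Lemma card_removable : #|{: removable}| = (#|L| * #|R|).+1.
Proof. by rewrite card_option card_sig -cardsX; congr S; apply: eq_card. Qed.

(** The pair removed at index [Some p] is an edge of every other member. *)
Lemma edges_cone_graph_inj : injective (fun j => edges (cone_graph j)).
Proof.
have key j x y : x \in L -> y \in R ->
    ([set x; y]%SET \in edges (cone_graph j)) = (omap val j != Some (x, y)).
  move=> xL yR; rewrite in_rel_edges ?cone_relLR //; first exact: cone_relC.
  by apply: contraTneq xL => ->; exact: notin_L.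
have sub j p : edges (cone_graph j) = edges (cone_graph (Some p)) ->
    j = Some p.
  case: p => -[x y] pLR; have /finset.setXP[xL yR] := pLR.
  move=> /(congr1 (fun E : {set {set V}} => [set x; y]%SET \in E)).
  rewrite !key //= eqxx /= => /negbFE/eqP.
  by case: j => //= q [qE]; congr Some; exact: val_inj.
move=> [p|] [q|] //= E; [exact: sub|exact/esym/sub/esym|exact: sub].
Qed.

Lemma cone_graph_mis (U : {set V}) : exists I e,
  is_mis (cone_graph None) U I /\ forall j, j != e -> is_mis (cone_graph j) U I.
Proof.
pose K := (z |: (L :|: R))%SET.
have misL j : (exists x, x \in (L :&: U)%SET) ->
    {in (R :&: U)%SET, forall y, exists2 x, x \in (L :&: U)%SET &
       omap val j != Some (x, y)} ->
    is_mis (cone_graph j) U (U :\: (K :\: L)).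
  move=> [x0 /finset.setIP[x0L x0U]] dom.
  apply: is_mis_rel_graph (@cone_rel_indL _) _; first exact: cone_relC.
    exact: cone_rel_core.
  move=> u uU; rewrite !inE => /or3P[/eqP ->|->//|uR] uL.
    by exists x0; rewrite // x0U cone_relz // inE x0L.
  have [|x /finset.setIP[xL xU] jx] := dom u; first by rewrite inE uR.
  by exists x; rewrite // xU cone_relC cone_relLR.
have misR j : (exists y, y \in (R :&: U)%SET) ->
    {in (L :&: U)%SET, forall x, exists2 y, y \in (R :&: U)%SET &
       omap val j != Some (x, y)} ->
    is_mis (cone_graph j) U (U :\: (K :\: R)).
  move=> [y0 /finset.setIP[y0R y0U]] dom.
  apply: is_mis_rel_graph (@cone_rel_indR _) _; first exact: cone_relC.
    exact: cone_rel_core.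
  move=> u uU; rewrite !inE => /or3P[/eqP ->|uL|->//] uR.
    by exists y0; rewrite // y0U cone_relz // inE y0R orbT.
  have [|y /finset.setIP[yR yU] jy] := dom u; first by rewrite inE uL.
  by exists y; rewrite // yU cone_relLR.
(* A single deletion spoils at most one of two candidate neighbours. *)
have two (A : {set V}) (f : V -> V * V) (j : option (V * V)) :
    injective f -> (1 < #|A|)%N -> exists2 x, x \in A & j != Some (f x).
  move=> fI /card_gt1P[x [y [xA yA xy]]].
  have [jx|jx] := eqVneq j (Some (f x)); last by exists x.
  by exists y; rewrite // jx; apply: contraNneq xy => -[/fI ->].
have [L0|[x xLU]] := finset.set_0Vmem (L :&: U)%SET.
  have [R0|[y yRU]] := finset.set_0Vmem (R :&: U)%SET.
    (* Of the core only [z] can lie in [U]. As in every case but the last, the answer is valid for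
       all indices and the exceptional index [None] is a dummy. *)
    exists (U :\: (K :\: [set z]))%SET, None.
    have mis j : is_mis (cone_graph j) U (U :\: (K :\: [set z]))%SET.
      apply: is_mis_rel_graph; first exact: cone_relC.
      - exact: cone_rel_core.
      - by move=> x y /set1P -> /set1P ->; rewrite cone_rel_irr.
      - move=> u uU; rewrite !inE => /or3P[-> //|uX|uX] _.
          by have := finset.in_set0 u; rewrite -L0 inE uX uU.
        by have := finset.in_set0 u; rewrite -R0 inE uX uU.
    by split.
  exists (U :\: (K :\: R))%SET, None.
  have mis j : is_mis (cone_graph j) U (U :\: (K :\: R))%SET.
    by apply: misR; [exists y|move=> x; rewrite L0 inE].
  by split.
have [Lle|Lgt] := leqP #|(L :&: U)%SET| 1; last first.
  exists (U :\: (K :\: L))%SET, None.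
  have mis j : is_mis (cone_graph j) U (U :\: (K :\: L))%SET.
    by apply: misL; [exists x|move=> y _; apply: two => // ? ? []].
  by split.
have [Rle|Rgt] := leqP #|(R :&: U)%SET| 1; last first.
  exists (U :\: (K :\: R))%SET, None.
  have mis j : is_mis (cone_graph j) U (U :\: (K :\: R))%SET.
    apply: misR; last by move=> ? _; apply: two => // ? ? [].
    by have /card_gt0P[y] := ltnW Rgt; exists y.
  by split.
have [R0|[y yRU]] := finset.set_0Vmem (R :&: U)%SET.
  exists (U :\: (K :\: L))%SET, None.
  have mis j : is_mis (cone_graph j) U (U :\: (K :\: L))%SET.
    by apply: misL; [exists x|move=> y; rewrite R0 inE].
  by split.
(* Now [U] meets [L] in [x] alone and [R] in [y] alone: keeping [x] and dropping [y] is maximal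
   unless [xy] was deleted. *)
have xyLR : (x, y) \in finset.setX L R.
  by move: xLU yRU; rewrite !inE /= => /andP[-> _] /andP[-> _].
exists (U :\: (K :\: L))%SET, (Some (exist _ (x, y) xyLR)).
have mis j : omap val j != Some (x, y) ->
    is_mis (cone_graph j) U (U :\: (K :\: L))%SET.
  move=> jxy; apply: misL; first by exists x.
  move=> y' y'RU; exists x => //.
  by rewrite (card_le1_eqP Rle y y').
split; first exact: mis.
move=> j jxy; apply: mis; apply: contra_neq jxy.
by case: j => //= q [qE]; congr Some; exact: val_inj.
Qed.

End HardGraphs.

(** * One-edge graphs, for maximum degree 1 *)

Definition single_edge (V : finType) (x y : V) : rel V :=
  fun u v => ((u == x) && (v == y)) || ((v == x) && (u == y)).

Lemma single_edgeC (V : finType) (x y : V) : symmetric (single_edge x y).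
Proof. by move=> u v; rewrite /single_edge orbC. Qed.

Lemma max_degree_single_edge (V : finType) (x y : V) : x != y ->
  max_degree (rel_graph (single_edge x y)) = 1%N.
Proof.
move=> xy.
have irr : irreflexive (single_edge x y).
  move=> u; rewrite /single_edge orbb; apply: contraNF xy => /andP[/eqP <-].
  by move=> /eqP <-.
have deg := degree_rel_graph _ (@single_edgeC V x y) irr.
apply/eqP; rewrite eqn_leq; apply/andP; split.
  apply/bigmax_leqP => v _; rewrite deg; apply/card_le1_eqP => u w.
  rewrite !inE /single_edge => /orP[]/andP[/eqP -> /eqP ->]
    /orP[]/andP[/eqP ? /eqP ?];
    subst; rewrite ?eqxx in xy *; by [].
apply: leq_trans (leq_bigmax x); rewrite deg.
by apply/card_gt0P; exists y; rewrite inE /single_edge !eqxx.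
Qed.

Theorem theorem7 (R : realType) :
  exists2 c : R, 0 < c &
    forall (Delta : nat) (V : finType),
      (0 < Delta)%N -> (Delta < #|V|)%N -> (2 < #|V|)%N ->
    forall (d : measure_display) (Omega : measurableType d)
           (P : probability Omega R) (A : Omega -> algorithm V),
      (forall S : set (algorithm V), measurable (A @^-1` S)) ->
      (forall (G : sgraph V) (O : oracle V),
         max_degree G = Delta -> mis_oracle G O ->
         ((2^-1 : R)%:E < P [set w | output (A w) O = edges G])%E) ->
    exists (G : sgraph V) (O : oracle V),
      [/\ max_degree G = Delta, mis_oracle G O &
          (0 < P [set w | (c * Delta%:R ^+ 2 <= (num_queries (A w) O)%:R)%R])%E].
Proof.
(* The 16 is 2 times 8: 2 from [#|J|.-1 <= 2 * num_queries], and 8 from [Delta ^ 2 <= 8 * #|J|.-1],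
   which leaves room for the rounding when [Delta] is halved. *)
exists 16%:R^-1; first by rewrite invr_gt0 ltr0n.
move=> Delta V D0 DV V2 d Omega P A mA succ.
suff [J [j0 [G [injG degG sepG cardJ]]]] :
    exists (J : finType) (j0 : J) (G : J -> sgraph V),
    [/\ injective (fun j => edges (G j)), forall j, max_degree (G j) = Delta,
       forall U, exists I e,
         is_mis (G j0) U I /\ forall j, j != e -> is_mis (G j) U I
       & (Delta ^ 2 <= 8 * #|J|.-1)%N].
  have [orc misO PO] := indistinguishable_family mA succ injG degG sepG.
  exists (G j0), orc; split => //; apply: lt_le_trans PO _.
  apply: le_measure; rewrite ?inE.
  - exact: (mA [set a | (#|J|.-1 <= 2 * num_queries a orc)%N]).
  - exact: (mA [set a | (16%:R^-1 * Delta%:R ^+ 2 <=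
      (num_queries a orc)%:R :> R)%R]).
  move=> w /= Jq; rewrite mulrC ler_pdivrMr ?ltr0n // -natrX -natrM ler_nat.
  apply: (leq_trans cardJ).
  rewrite [leqRHS]mulnC -[16%N]/(8 * 2)%N -mulnA leq_mul2l.
  by rewrite orbC Jq.
(* For [Delta = 1] halving would make [L] empty and the family trivial. The edges [xy] and [xz] are
   used instead, which takes three vertices. *)
have [D1|D2] := leqP Delta 1.
  have {D0 D1 DV} -> : Delta = 1%N by apply/eqP; rewrite eqn_leq D1.
  have /card_gt2P[x [y [z [_ [xy yz zx]]]]] : (2 < #|{: V}|)%N by [].
  pose r (b : bool) := single_edge x (if b then y else z).
  exists bool, true, (fun b => rel_graph (r b)); split.
  - have inxy b : ([set x; y]%SET \in rel_edges (r b)) = b.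
      rewrite in_rel_edges //; last exact: single_edgeC.
      rewrite /r /single_edge eqxx (eq_sym y x) (negPf xy) orbF /=.
      by case: b; rewrite ?eqxx // (negPf yz).
    by move=> b b' /= E; rewrite -(inxy b) E inxy.
  - by case; apply: max_degree_single_edge; rewrite // eq_sym.
  - move=> U; have [I mI] := mis_exists (rel_graph (r true)) U.
    (* With two graphs, the second one may be the exception to every query. *)
    by exists I, false; split => // -[].
  - by rewrite card_bool.
pose a := Delta./2; pose b := (Delta - a)%N.
have [L _ cardL] : exists2 L : {set V}, L \subset [set: V]%SET & #|L| = a.
  by apply: subset_of_card; rewrite cardsT /a; lia.
have [B BL cardB] : exists2 B : {set V}, B \subset (~: L)%SET & #|B| = b.
  apply: subset_of_card.
  by have := cardsC L; rewrite cardL /a /b; lia.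
have dLB : {in L, forall x, x \notin B}.
  move=> x xL; apply/negP => /(fintype.subsetP BL).
  by rewrite inE xL.
(* The two parts use [Delta] vertices in all, and [Delta < #|V|] leaves one for the apex. *)
have [z zLB] : exists z, z \in (~: (L :|: B))%SET.
  apply/card_gt0P; have := cardsC (L :|: B)%SET.
  have := cardsUI L B; rewrite cardL cardB /b /a; lia.
move: zLB; rewrite !inE negb_or => /andP[zL zB].
exists (removable L B), None, (@cone_graph V L B z); split.
- exact: edges_cone_graph_inj.
- by move=> j; rewrite max_degree_cone // cardL cardB /b /a; lia.
- exact: cone_graph_mis.
- rewrite card_removable cardL cardB /= /b /a.
  (* The product of the halves is at least [(Delta ^ 2 - 1) / 4], which is at least [Delta ^ 2 / 8]
     once [Delta >= 2]. *)
  have := odd_double_half Delta; case: (odd Delta); nia.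
Qed.
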